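(* Let $G$ be a finite simple connected graph of order $n>1$ with $\operatorname{diam}(G)\le 2$. Then there is at least one vertex $v\in V(G)$ such that either $G\setminus v$ is disconnected, or $W(G\setminus v)<W(G)$.
   Context: For a connected graph $G=(V,E)$, $d_G(u,v)$ denotes the length of a shortest path between $u$ and $v$, and the total distance (Wiener index) $W(G)$ is the sum of $d_G(u,v)$ over all unordered pairs of vertices $\{u,v\}\subseteq V$. The order of $G$ is $|V|$. $\operatorname{diam}(G)=\max_{u,v\in V} d_G(u,v)$. $G\setminus v$ is the graph obtained from $G$ by deleting the vertex $v$ and its incident edges. *)

(* Defs.v *)
From mathcomp Require Import all_boot.

Set Implicit Arguments.
Unset Strict Implicit.
Unset Printing Implicit Defensive.

(* A finite simple graph is a symmetric irreflexive relation e (adjacency) on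
   a finType T of vertices. *)
Section Graph.

Variables (T : finType) (e : rel T).

Definition has_walk (n : nat) (u v : T) : bool :=
  [exists p : n.-tuple T, path e u p && (last u p == v)].

Definition gconnected : bool := [forall u, forall v, connect e u v].

(* The least length of a walk from u to v: a shortest one has fewer than #|T|
   edges.  The value is #|T| when v is not reachable from u. *)
Definition dist (u v : T) : nat :=
  find (fun n => has_walk n u v) (iota 0 #|T|).

Definition diam : nat := \max_(u : T) \max_(v : T) dist u v.

(* Each unordered pair of distinct vertices is counted once, in the order of
   the canonical enumeration of T. *)
Definition wiener : nat :=
  \sum_(u : T) \sum_(v : T | enum_rank u < enum_rank v) dist u v.

Lemma has_walkP n u v :
  reflect (exists p, [/\ path e u p, last u p = v & size p = n])
          (has_walk n u v).
Proof.
apply: (iffP existsP) => [[p /andP[pp /eqP pv]]|[p [pp pv /eqP sp]]].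
  by exists p; rewrite size_tuple.
by exists (Tuple sp); rewrite /= pp pv eqxx.
Qed.

Lemma dist_min u v p : path e u p -> last u p = v -> dist u v <= size p.
Proof.
move=> pp pv; case: (ltnP (size p) #|T|) => [ltp|]; last first.
  by apply: leq_trans; rewrite -[X in _ <= X](size_iota 0) find_size.
rewrite leqNgt; apply/negP => /(before_find 0); rewrite nth_iota // add0n.
by move/has_walkP; apply; exists p.
Qed.

Lemma dist_walk u v : connect e u v -> has_walk (dist u v) u v.
Proof.
case/connectP=> p0 /shortenP[p pp up _ pv].
have ltp : size p < #|T|.
  by have := max_card [in u :: p]; rewrite (card_uniqP up).
have hw : has (fun n => has_walk n u v) (iota 0 #|T|).
  by apply/hasP; exists (size p); [rewrite mem_iota | apply/has_walkP; exists p].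
have := nth_find 0 hw; rewrite nth_iota //.
by move: hw; rewrite has_find size_iota.
Qed.

Lemma has_walk_sym n : symmetric e -> symmetric (has_walk n).
Proof.
move=> es; suff h u v : has_walk n u v -> has_walk n v u.
  by move=> u v; apply/idP/idP; apply: h.
case/has_walkP=> p [pp <- <-]; apply/has_walkP; exists (rev (belast u p)).
rewrite size_rev size_belast rev_path (eq_path (e' := e)); last first.
  by move=> x y; apply: es.
split=> //.
by case: p {pp} => //= x p; rewrite rev_cons last_rcons.
Qed.

Lemma dist_sym : symmetric e -> commutative dist.
Proof. by move=> es u v; apply: eq_find => n; apply: has_walk_sym. Qed.

Lemma distxx u : dist u u = 0.
Proof. by apply/eqP; rewrite -leqn0; apply: (@dist_min u u [::]). Qed.

Lemma wiener_double :
  symmetric e -> wiener.*2 = \sum_(u : T) \sum_(v : T) dist u v.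
Proof.
move=> es; rewrite -addnn {2}/wiener.
rewrite (exchange_big_dep predT) //= -big_split /=; apply: eq_bigr => u _.
rewrite [RHS](bigID (fun v => enum_rank u < enum_rank v)) /=; congr (_ + _).
rewrite [RHS](bigD1 u) ?ltnn //= distxx add0n.
apply: eq_big => [v|v _]; last exact: dist_sym.
rewrite -leqNgt ltn_neqAle andbC; congr (_ && _).
by rewrite -(inj_eq enum_rank_inj) -(inj_eq val_inj).
Qed.

End Graph.

(* Adjacency of the graph obtained by deleting the vertex v; its vertex type is
   {x : T | x != v}. *)
Definition del_vertex (T : finType) (e : rel T) (v : T) :
    rel {x : T | x != v} :=
  fun x y => e (val x) (val y).

Arguments del_vertex {T} e v _ _.

(* Main.v *)
Require Import Defs.
From mathcomp Require Import all_boot.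

Set Implicit Arguments.
Unset Strict Implicit.
Unset Printing Implicit Defensive.

(** Write W for the Wiener index, n for the order and d for the distance.

    Suppose first that some vertex c is adjacent to all others.  Deleting any
    other vertex v changes no distance, because c is still there to join two
    nonadjacent vertices, and W loses the positive term d(v, c).

    Otherwise every vertex v has a non-neighbour z different from v.  As the
    diameter is at most 2, each remaining vertex is joined to z by a walk of
    length at most 2, which avoids v because v is not adjacent to z.  Hence
    any two vertices of G \ v are within distance 4 of each other, going
    through z ([dist_del_le4]); in particular G has no cut vertex.

    The vertex to delete is then found by averaging.  Choose for each pair
    (x, y) one common neighbour m(x, y), if there is any.  Deleting a vertex
    v other than x, y and m(x, y) does not change d(x, y), and deleting
    m(x, y) can only turn a distance 2 into at most 4, so it adds at most
    d(x, y).  On the other hand, deleting x or y removes the contribution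
    d(x, y) altogether.  So, summing over all v, the pair contributes at most
    (n - 2) d(x, y) + d(x, y) ([sum_del_pair]), and the sum of the numbers
    W(G \ v) is at most (n - 1) W(G) < n W(G): some W(G \ v) is smaller than
    W(G). *)

Lemma dist_gt0 (T : finType) (e : rel T) (x y : T) :
  gconnected e -> x != y -> 0 < dist e x y.
Proof.
move=> /forallP/(_ x)/forallP/(_ y) cxy; rewrite lt0n; apply: contraNN => /eqP d0.
have /has_walkP[p [_ pxy]] := dist_walk cxy.
by rewrite d0 -pxy => /eqP; rewrite size_eq0 => /eqP->.
Qed.

Lemma dist_gt1 (T : finType) (e : rel T) (x y : T) :
  gconnected e -> x != y -> ~~ e x y -> 1 < dist e x y.
Proof.
move=> ec xy; apply: contraNT; rewrite -leqNgt => d1.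
have {}d1 : dist e x y = 1 by apply/eqP; rewrite eqn_leq d1 dist_gt0.
have /has_walkP[p []] := dist_walk (forallP (forallP ec x) y).
by rewrite d1; case: p => [|z [|]] //=; rewrite andbT => ? <-.
Qed.

Lemma dist_le_diam (T : finType) (e : rel T) (x y : T) : dist e x y <= diam e.
Proof.
apply: leq_trans (leq_bigmax x).
exact: (leq_bigmax (F := fun y => dist e x y) y).
Qed.

Lemma common_neighbour (T : finType) (e : rel T) (x y : T) :
    gconnected e -> diam e <= 2 -> x != y -> ~~ e x y ->
  exists z, e x z && e z y.
Proof.
move=> ec d2 xy nexy; have dxy := dist_gt1 ec xy nexy.
have {}dxy : dist e x y = 2.
  by apply/eqP; rewrite eqn_leq dxy (leq_trans (dist_le_diam e x y)).
have /has_walkP[p []] := dist_walk (forallP (forallP ec x) y).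
rewrite dxy; case: p => [|a [|b [|//]]] //= /and3P[exa eab _] <- _.
by exists a; rewrite exa.
Qed.

(** A shortest walk from [u] to [w] has at most one inner vertex, so the only
    way for the deletion of [v] to destroy it is that [v] is this vertex;
    another common neighbour can then replace [v]. *)
Lemma walk_del (T : finType) (e : rel T) (v : T) (u w : {x : T | x != v}) :
    gconnected e -> diam e <= 2 ->
    (val u != val w -> ~~ e (val u) (val w) -> e (val u) v -> e v (val w) ->
      exists2 z, z != v & e (val u) z && e z (val w)) ->
  exists p, [/\ path (del_vertex e v) u p, last u p = w
             & size p <= dist e (val u) (val w)].
Proof.
move=> ec d2 hz.
have [/val_inj->|uw] := eqVneq (val u) (val w); first by exists [::].
case: (boolP (e (val u) (val w))) => [euw|neuw].
  by exists [:: w]; rewrite /= andbT; split=> //; apply: dist_gt0.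
suff [z zv ez] : exists2 z, z != v & e (val u) z && e z (val w).
  exists [:: exist _ z zv; w]; rewrite /= andbT; split=> //.
  exact: dist_gt1.
have [a eaw] := common_neighbour ec d2 uw neuw.
have [av|av] := eqVneq a v; last by exists a.
by move: eaw; rewrite av => /andP[euv evw]; apply: hz.
Qed.

Lemma dist_del_le (T : finType) (e : rel T) (v : T) (u w : {x : T | x != v}) :
    gconnected e -> diam e <= 2 ->
    (val u != val w -> ~~ e (val u) (val w) -> e (val u) v -> e v (val w) ->
      exists2 z, z != v & e (val u) z && e z (val w)) ->
  dist (del_vertex e v) u w <= dist e (val u) (val w).
Proof.
move=> ec d2 /(walk_del ec d2)[p [pp pw]]; apply: leq_trans.
exact: dist_min pp pw.
Qed.

(** The vertex [v] is not the middle of any walk of length 2 from or to its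
    non-neighbour [z], so [z] stays within distance 2 of [u] and of [w]. *)
Lemma dist_del_le4 (T : finType) (e : rel T) (v z : T)
    (u w : {x : T | x != v}) :
    symmetric e -> gconnected e -> diam e <= 2 -> z != v -> ~~ e v z ->
  dist (del_vertex e v) u w <= 4.
Proof.
move=> es ec d2 zv nevz; pose z' : {x : T | x != v} := exist _ z zv.
have [p [pp pz sp]] : exists p, [/\ path (del_vertex e v) u p, last u p = z'
    & size p <= dist e (val u) z].
  by apply: (@walk_del _ _ _ u z') => //= _ _ _; rewrite (negPf nevz).
have [q [pq qw sq]] : exists q, [/\ path (del_vertex e v) z' q, last z' q = w
    & size q <= dist e z (val w)].
  by apply: (@walk_del _ _ _ z' w) => //= _ _; rewrite es (negPf nevz).
have pqw : path (del_vertex e v) u (p ++ q) by rewrite cat_path pz pp.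
apply: leq_trans (dist_min (v := w) pqw _) _; first by rewrite last_cat pz.
rewrite size_cat (@leq_add _ _ 2 2) //.
  exact: leq_trans sp (leq_trans (dist_le_diam e _ _) d2).
exact: leq_trans sq (leq_trans (dist_le_diam e _ _) d2).
Qed.

(** The default value is an endpoint of the pair, because deleting an endpoint
    never lengthens a distance that still has to be counted. *)
Definition midpoint (T : finType) (e : rel T) (x y : T) : T :=
  odflt x [pick z | e x z && e z y].

(** Deleting the midpoint of a pair costs at most the distance of the pair:
    it can only turn a distance 2 into at most 4. *)
Lemma dist_del_midpoint (T : finType) (e : rel T) (v z : T)
    (u w : {x : T | x != v}) :
    symmetric e -> gconnected e -> diam e <= 2 -> z != v -> ~~ e v z ->
  dist (del_vertex e v) u w <=
    dist e (val u) (val w) +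
    dist e (val u) (val w) * (v == midpoint e (val u) (val w)).
Proof.
move=> es ec d2 zv nevz; case: eqVneq => [_|vm].
  rewrite muln1; have [uw|uw] := eqVneq (val u) (val w).
    by rewrite (val_inj uw) distxx.
  case: (boolP (e (val u) (val w))) => [euw|neuw].
    apply: leq_trans (leq_addr _ _); apply: dist_del_le => //.
    by rewrite euw.
  apply: leq_trans (dist_del_le4 _ _ es ec d2 zv nevz) _.
  by rewrite (@leq_add 2 2) // dist_gt1.
rewrite muln0 addn0; apply: dist_del_le => // _ _ euv evw.
exists (midpoint e (val u) (val w)); first by rewrite eq_sym.
by rewrite /midpoint; case: pickP => //= /(_ v); rewrite euv evw.
Qed.

Lemma wiener_del_double_le (T : finType) (e : rel T) (v : T)
    (g : T -> T -> nat) :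
    symmetric e ->
    (forall u w, dist (del_vertex e v) u w <= g (val u) (val w)) ->
  (wiener (del_vertex e v)).*2 <=
    \sum_(x | x != v) \sum_(y | y != v) g x y.
Proof.
move=> es hg; rewrite wiener_double; last by move=> x y; apply: es.
rewrite (big_sub (fun x => x != v)) leq_sum // => u _.
by rewrite (big_sub (fun x => x != v)) leq_sum.
Qed.

(** A vertex adjacent to all the others is a common neighbour that survives
    the deletion of [v], so that no distance changes. *)
Lemma wiener_del_universal (T : finType) (e : rel T) (c v : T) :
    symmetric e -> gconnected e -> diam e <= 2 ->
    (forall x, x != c -> e c x) -> v != c ->
  wiener (del_vertex e v) < wiener e.
Proof.
move=> es ec d2 hc vc; rewrite -ltn_double [X in _ < X]wiener_double //.
have le_del : (wiener (del_vertex e v)).*2 <=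
    \sum_(x | x != v) \sum_(y | y != v) dist e x y.
  apply: wiener_del_double_le => // u w; apply: dist_del_le => // uw neuw _ _.
  exists c; first by rewrite eq_sym.
  have uc : val u != c.
    apply: contraNneq neuw => uc; rewrite uc in uw *.
    by apply: hc; rewrite eq_sym.
  have wc : val w != c by apply: contraNneq neuw => ->; rewrite es hc.
  by rewrite es !hc.
(* The terms in the row of v, among them dist e v c, are lost. *)
apply: leq_ltn_trans le_del _; rewrite [X in _ < X](bigD1 v) //= addnC.
rewrite -[X in X < _]addn0 -addnS leq_add //.
  apply: leq_sum => x _; rewrite [X in _ <= X](bigID (fun y => y != v)) /=.
  exact: leq_addr.
rewrite (bigD1 c) //= ltn_addr //; exact: dist_gt0.
Qed.

(** If the endpoints [x] and [y] differ, two of the [#|T|] deletions remove one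
    of them, and at most one other removes the midpoint [m] and counts [d]
    twice: on the whole [d] is counted at most [#|T| - 2 + 1] times. *)
Lemma sum_del_pair (T : finType) (x y m : T) (d : nat) :
    (x == y -> d = 0) ->
  \sum_v (if (x != v) && (y != v) then d + d * (v == m) else 0) + d
    <= #|T| * d.
Proof.
move=> d0; have [xy|xy] := eqVneq x y.
  rewrite (d0 _) ?xy // muln0 addn0 big1 // => v _.
  by case: ifP => // _.
have sum1 (a : T) : \sum_v d * (v == a) = d.
  rewrite (bigD1 a) //= eqxx muln1 big1 ?addn0 // => v /negPf->.
  by rewrite muln0.
suff : \sum_v ((if (x != v) && (y != v) then d + d * (v == m) else 0) +
    (d * (v == x) + d * (v == y))) <= \sum_(v : T) (d + d * (v == m)).
  by rewrite !big_split /= !sum1 sum_nat_const addnA leq_add2r.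
apply: leq_sum => v _.
rewrite ![v == _]eq_sym; have [<-|_] := eqVneq x v.
  by rewrite eq_sym (negPf xy) muln1 muln0 addn0 add0n leq_addr.
have [_|_] /= := eqVneq y v; first by rewrite muln1 muln0 !add0n leq_addr.
by rewrite muln0 !addn0.
Qed.

Theorem proposition4 (T : finType) (e : rel T)
  (e_sym : symmetric e) (e_irrefl : irreflexive e)
  (e_conn : gconnected e) (order_gt1 : 1 < #|T|) (diam_le2 : diam e <= 2) :
  exists v : T,
    ~~ gconnected (del_vertex e v) \/ wiener (del_vertex e v) < wiener e.
Proof.
suff [v lt_v] : exists v, wiener (del_vertex e v) < wiener e by exists v; right.
have [a [b [_ _ ab]]] : exists a b : T, [/\ a \in T, b \in T & a != b].
  by apply/card_gt1P; rewrite (eq_card (B := predT)).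
case: (boolP [exists c, [forall x, (x != c) ==> e c x]]) => [/existsP[c]|].
  move=> /forallP hc; exists (if a == c then b else a).
  apply: (wiener_del_universal e_sym e_conn diam_le2).
    by move=> x; apply/implyP/hc.
  by have [<-|//] := eqVneq a c; rewrite eq_sym.
move=> /existsPn nuniv.
case: (boolP [exists v, wiener (del_vertex e v) < wiener e]) => [/existsP//|].
move=> /existsPn not_lt; pose D := \sum_x \sum_y dist e x y.
have D_gt0 : 0 < D.
  by rewrite /D (bigD1 a) //= (bigD1 b) ?ltn_addr ?dist_gt0 // eq_sym.
pose g v x y := dist e x y + dist e x y * (v == midpoint e x y).
pose S := \sum_v \sum_x \sum_y (if (x != v) && (y != v) then g v x y else 0).
have nD_le : #|T| * D <= S.
  rewrite -sum_nat_const; apply: leq_sum => v _.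
  rewrite /D -wiener_double //; have := not_lt v; rewrite -leqNgt -leq_double.
  move=> /leq_trans; apply.
  have /forallPn[z] := nuniv v; rewrite negb_imply => /andP[zv nevz].
  have le_g u w : dist (del_vertex e v) u w <= g v (val u) (val w).
    exact: dist_del_midpoint nevz.
  apply: leq_trans (wiener_del_double_le e_sym le_g) _.
  rewrite big_mkcond leq_sum // => x _; case: eqVneq => //= _.
  by rewrite big_mkcond.
have S_le : S + D <= #|T| * D.
  rewrite /S exchange_big /D -big_split big_distrr /= leq_sum // => x _.
  rewrite exchange_big -big_split big_distrr /= leq_sum // => y _.
  by apply: sum_del_pair => /eqP->; rewrite distxx.
have := leq_trans S_le nD_le.
by rewrite -[X in _ <= X]addn0 leq_add2l leqNgt D_gt0.
Qed.
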